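(* (i) Suppose that a triple of space change, time change and BH-function $q_\varepsilon(t),\tau(\varepsilon,t),G(\varepsilon,t)$ satisfies the infinitesimal BH-invariance under space and time change. Define the new space change $Q_{1,\varepsilon}(t)$ in either of the following two ways: $$Q_{1,\varepsilon}(t):=q_\varepsilon\bigl(t+\varepsilon\cdot(\partial_\epsilon\tau(\epsilon,t)|_{\epsilon=0})\bigr),\qquad Q_{1,\varepsilon}(t):=q_\varepsilon(t)+\varepsilon\cdot(\partial_\epsilon\tau(\epsilon,t)|_{\epsilon=0})\,\dot q(t),$$ and set $\theta_\varepsilon(t):=\tau(\varepsilon,t)$. Then the triple $Q_{1,\varepsilon}(t),\theta_\varepsilon(t),G(\varepsilon,t)$ satisfies the infinitesimal alternative BH-invariance under space and time change. (ii) Conversely, suppose that a triple of space change, time change and BH-function $q_\varepsilon(t),\theta_\varepsilon(t),G(\varepsilon,t)$ satisfies the infinitesimal alternative BH-invariance under space and time change. Define the new space change $Q_{2,\varepsilon}(t)$ in either of the following two ways: $$Q_{2,\varepsilon}(t):=q_\varepsilon\bigl(t-\varepsilon\cdot(\partial_\epsilon\theta_\epsilon(t)|_{\epsilon=0})\bigr),\qquad Q_{2,\varepsilon}(t):=q_\varepsilon(t)-\varepsilon\cdot(\partial_\epsilon\theta_\epsilon(t)|_{\epsilon=0})\,\dot q(t),$$ and set $\tau(\varepsilon,t):=\theta_\varepsilon(t)$. Then the triple $Q_{2,\varepsilon}(t),\tau(\varepsilon,t),G(\varepsilon,t)$ satisfies the infinitesimal BH-invariance under space and time change.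
   Context: Let $n\ge1$ and let $L=L(t,q,\dot q)$ (the Lagrangian) be a smooth real-valued function on an open subset of $\mathbb{R}\times\mathbb{R}^n\times\mathbb{R}^n$. A dot over a function denotes the derivative in $t$. Let $t\mapsto q(t)\in\mathbb{R}^n$ be a smooth trajectory (not necessarily a solution to the Lagrange equation) on an open interval $I$ such that $(t,q(t),\dot q(t))$ lies in the domain of $L$ for all $t\in I$. All functions of $(\varepsilon,t)$ below are defined on an open neighbourhood of $\{0\}\times I$ in $\mathbb{R}\times I$ (i.e. for $t\in I$ and $\varepsilon$ close to $0$). A space change of $q$ is a smooth one-parameter family $(\varepsilon,t)\mapsto q_\varepsilon(t)\in\mathbb{R}^n$ with $q_0(t)=q(t)$ for all $t\in I$. A time change is a smooth real function, written $\tau(\varepsilon,t)$ or $\theta_\varepsilon(t)$, with $\tau(0,t)=t$ (resp. $\theta_0(t)=t$) for all $t\in I$; $\theta_\varepsilon'$ is the derivative in $t$ and $\theta_\varepsilon^{-1}$ the inverse with respect to $t$. A BH-function is a smooth real function $G(\varepsilon,t)$. The Hamiltonian action is $A_{a,b}(q)=\int_a^bL(t,q(t),\dot q(t))\,dt$. Infinitesimal BH-invariance under space and time change for $(q_\varepsilon,\tau,G)$ means $$\frac{\partial}{\partial\varepsilon}\Bigl(A_{\tau(\varepsilon,a),\tau(\varepsilon,b)}(q_\varepsilon)+G(\varepsilon,b)-G(\varepsilon,a)\Bigr)\Big|_{\varepsilon=0}=0\quad\forall a,b\in I,$$ equivalently $$\frac{\partial}{\partial\varepsilon}\Bigl(L\bigl(\tau(\varepsilon,t),q_\varepsilon(\tau(\varepsilon,t)),\dot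 q_\varepsilon(\tau(\varepsilon,t))\bigr)\partial_t\tau(\varepsilon,t)+\partial_tG(\varepsilon,t)\Bigr)\Big|_{\varepsilon=0}=0\quad\forall t\in I .$$ Infinitesimal alternative BH-invariance under space and time change for $(q_\varepsilon,\theta_\varepsilon,G)$ means that, with $\tilde q_\varepsilon:=q_\varepsilon\circ\theta_\varepsilon^{-1}$, $$\frac{\partial}{\partial\varepsilon}\Bigl(A_{\theta_\varepsilon(a),\theta_\varepsilon(b)}(\tilde q_\varepsilon)+G(\varepsilon,b)-G(\varepsilon,a)\Bigr)\Big|_{\varepsilon=0}=0\quad\forall a,b\in I,$$ equivalently $$\frac{\partial}{\partial\varepsilon}\biggl(L\Bigl(\theta_\varepsilon(t),q_\varepsilon(t),\frac{\dot q_\varepsilon(t)}{\theta_\varepsilon'(t)}\Bigr)\theta_\varepsilon'(t)+\partial_tG(\varepsilon,t)\biggr)\bigg|_{\varepsilon=0}=0\quad\forall t\in I .$$ *)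

(* Defs.v *)
From HB Require Import structures.
From mathcomp Require Import all_boot all_order all_algebra.
From mathcomp Require Import all_classical all_reals all_analysis.

Set Implicit Arguments.
Unset Strict Implicit.
Unset Printing Implicit Defensive.

Import Order.TTheory GRing.Theory Num.Theory.
Import numFieldNormedType.Exports.

Local Open Scope classical_set_scope.
Local Open Scope ring_scope.

(* For [U] open and [V] finite-dimensional this is the usual class C^k:
   continuity for [k = 0]; then (Frechet) differentiability at every point of
   [U] with all directional derivatives of class C^(k-1) on [U].  Values of [f]
   outside [U] are irrelevant, so total functions stand for functions on [U]. *)
Fixpoint Ck_on (R : realType) (V W : normedModType R) (k : nat)
    (U : set V) (f : V -> W) : Prop :=
  match k with
  | 0 => forall x, U x -> {for x, continuous f}
  | k'.+1 => (forall x, U x -> differentiable f x) /\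
             forall v, Ck_on k' U (fun x => 'D_v f x)
  end.

Definition smooth_on (R : realType) (V W : normedModType R)
    (U : set V) (f : V -> W) : Prop :=
  forall k, Ck_on k U f.

(* Families [f (eps, t)] are smooth on some open neighbourhood of {0} x I in
   R x I, which may depend on the family and be thin. *)
Definition smooth_family (R : realType) (W : normedModType R)
    (I : set R) (f : R * R -> W) : Prop :=
  exists N : set (R * R),
    [/\ open N, (forall t, I t -> N (0, t)), N `<=` [set x | I x.2]
      & smooth_on N f].

Definition space_change (R : realType) (n : nat) (I : set R)
    (q : R -> 'rV[R]_n) (qe : R * R -> 'rV[R]_n) : Prop :=
  smooth_family I qe /\ forall t, I t -> qe (0, t) = q t.

Definition time_change (R : realType) (I : set R) (tau : R * R -> R) : Prop :=
  smooth_family I tau /\ forall t, I t -> tau (0, t) = t.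

Definition BH_function (R : realType) (I : set R) (G : R * R -> R) : Prop :=
  smooth_family I G.

(* Integral from [a] to [b] with orientation: no order between [a] and [b]. *)
Definition oriented_integral (R : realType) (a b : R) (f : R -> R) : R :=
  if a <= b then \int[lebesgue_measure]_(t in `[a, b]) f t
  else - \int[lebesgue_measure]_(t in `[b, a]) f t.

Definition action (R : realType) (n : nat)
    (L : R * 'rV[R]_n * 'rV[R]_n -> R) (a b : R) (q : R -> 'rV[R]_n) : R :=
  oriented_integral a b (fun t => L (t, q t, derive1 q t)).

(* [is_derive 0 1 F 0] says that [F] is derivable at 0 with derivative 0; only
   the germ of [F] at 0 matters. For [eps] close to 0, the compact segment
   between [tau (eps, a)] and [tau (eps, b)] is inside the domain of
   [qe (eps, _)]. *)
Definition BH_invariant (R : realType) (n : nat)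
    (L : R * 'rV[R]_n * 'rV[R]_n -> R) (I : set R)
    (qe : R * R -> 'rV[R]_n) (tau G : R * R -> R) : Prop :=
  forall a b, I a -> I b ->
    is_derive (0 : R) 1
      (fun e => action L (tau (e, a)) (tau (e, b)) (fun t => qe (e, t))
                + G (e, b) - G (e, a)) 0.

(* The inverse in [t] of [theta (e, _)] along the segment with endpoints [a]
   and [b]. A time change need not be injective on its whole domain for fixed
   [e], but for [e] close to 0 it is a diffeomorphism near this segment, which
   it maps onto the segment with endpoints [theta (e, a)], [theta (e, b)].
   The value [a] outside the image of the segment is a dummy. *)
Definition time_inverse (R : realType) (theta : R * R -> R) (a b e : R) :
    R -> R :=
  'pinv_(fun=> a) `[Num.min a b, Num.max a b] (fun t => theta (e, t)).

Definition alt_BH_invariant (R : realType) (n : nat)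
    (L : R * 'rV[R]_n * 'rV[R]_n -> R) (I : set R)
    (qe : R * R -> 'rV[R]_n) (theta G : R * R -> R) : Prop :=
  forall a b, I a -> I b ->
    is_derive (0 : R) 1
      (fun e => action L (theta (e, a)) (theta (e, b))
                  (fun s => qe (e, time_inverse theta a b e s))
                + G (e, b) - G (e, a)) 0.

Definition time_velocity (R : realType) (tau : R * R -> R) (t : R) : R :=
  derive1 (fun e => tau (e, t)) 0.

(* The two ways of transferring a time shift [e * sigma t] to a space change. *)
Definition shift_arg (R : realType) (n : nat) (sigma : R -> R)
    (qe : R * R -> 'rV[R]_n) : R * R -> 'rV[R]_n :=
  fun x => qe (x.1, x.2 + x.1 * sigma x.2).

Definition shift_val (R : realType) (n : nat) (sigma : R -> R)
    (q : R -> 'rV[R]_n) (qe : R * R -> 'rV[R]_n) : R * R -> 'rV[R]_n :=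
  fun x => qe x + (x.1 * sigma x.2) *: derive1 q x.2.

(* Main.v *)
Require Import Defs.
From HB Require Import structures.
From mathcomp Require Import all_boot all_order all_algebra.
From mathcomp Require Import all_classical all_reals all_analysis.
Import Order.TTheory GRing.Theory Num.Theory.
Import numFieldNormedType.Exports.
Local Open Scope classical_set_scope.
Local Open Scope ring_scope.

(** Only the first-order behaviour in [eps] of the space change and of the time
    change matters.  Let [s t] be the velocity of the time change at [eps = 0].
    Both ways of defining the new space change from the old one change its
    derivative at [eps = 0] by [s q'] in part (i) and by [- s q'] in part (ii)
    ([shift_arg_d_eps], [shift_val_d_eps]).  So it is enough to show that, for
    two space changes [P] and [Q] with [d_eps Q = d_eps P + s q'] on [{0} x I],
    the BH-invariance of [P] and the alternative BH-invariance of [Q] are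
    equivalent ([BH_invariant_iff_alt]).  The new space change is [Q] in part
    (i) and [P] in part (ii).

    For this, both actions are pulled back to the original time by a change of
    variables ([action_change], [action_inverse_change]).  They become integrals
    over the fixed segment [[a, b]] of
    [L (tau, P (eps, tau), P' (eps, tau)) * tau'] and of
    [L (tau, Q, Q' / tau') * tau'], where a prime is the time derivative and
    functions without argument are taken at [(eps, t)].
    The arguments of [L] agree at [eps = 0], and so do their derivatives in
    [eps] ([d_eps_states]): in the velocity components Schwarz's theorem
    ([derive_comm]) gives [(s q')' - s' q' = s q''] for the second integrand,
    which is what reading [P'] at the time [tau] gives for the first.  Hence the
    difference of the integrands is [o(eps)], uniformly on [[a, b]] by
    compactness ([uniformly_little_o]), and the difference of the two actions is
    [o(eps)]: one of them, corrected by the [G]-terms, is stationary if and only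
    if the other one is.

    The change of variables and the uniform estimate need the integrands to be
    C^1 on an open neighbourhood of [{0} x I]; this rests on a calculus of C^k
    maps on open sets, whose main point is the stability under composition
    ([Ck_comp]). *)

Set Implicit Arguments.
Unset Strict Implicit.
Unset Printing Implicit Defensive.

(** * Directional derivatives *)

Section Calculus.
Context {R : realType}.
Implicit Types V W X : normedModType R.

(** Differentiability depends on the germ only: the first-order expansion of
    [f] at [x] is also one of [g], since the two functions have the same
    increments near [x]. *)
Lemma near_eq_differentiable V W (f g : V -> W) (x : V) :
  {near x, f =1 g} -> differentiable f x -> differentiable g x.
Proof.
move=> fg df.
have gx : g x = f x by rewrite (nbhs_singleton fg).
have E : g \o shift x = cst (g x) + 'd f x +o_ 0 id.
  apply/eqaddoP => e e0.
  have /eqaddoP/(_ e e0) H := diff_locally df.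
  have fg0 : \forall y \near (0 : V), f (y + x) = g (y + x).
    have c : (fun y => y + x) @ (0 : V) --> 0 + x.
      by apply: cvgD; [exact: cvg_id|exact: cvg_cst].
    by rewrite add0r in c; exact: c fg.
  by apply: filterS2 fg0 H => y fgy; rewrite !fctE /= gx fgy.
have [cdf _] := (diff_locallyP _ _).1 df.
have D : 'd g x = 'd f x :> (V -> W) by exact: diff_unique cdf E.
by apply/diff_locallyP; rewrite D.
Qed.

Lemma lscaler_bilinear V :
  bilinear_for (GRing.Scale.Law.clone _ _ *:%R _)
    (GRing.Scale.Law.clone _ _ *:%R _) (fun (a : R) (v : V) => a *: v).
Proof.
split=> [u|u] a x y /=; first by rewrite scalerDl scalerA.
by rewrite scalerDr !scalerA mulrC.
Qed.

(** The product rule for a scalar function times a vector function: scaling is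
    a continuous bilinear map, composed here with the pair of factors. *)
Lemma is_diff_scale V W (a : V -> R) (f : V -> W) (x : V) :
  differentiable a x -> differentiable f x ->
  is_diff x (fun y => a y *: f y) (fun h => a x *: 'd f x h + 'd a x h *: f x).
Proof.
move=> da df.
pose bM := bilinear_isBilinear.Build R R W W _ _ _ (lscaler_bilinear W).
pose b : {bilinear R -> W -> W} := HB.pack (fun (a : R) (v : W) => a *: v) bM.
have bc : continuous (fun p : R * W => b p.1 p.2) by exact: scale_continuous.
have db : is_diff (a x, f x) (fun p : R * W => b p.1 p.2)
    (fun q => a x *: q.2 + q.1 *: f x).
  by apply: DiffDef; [exact: differentiable_bilin|rewrite diff_bilin].
have dp : is_diff x (fun y => (a y, f y)) (fun y => ('d a x y, 'd f x y)).
  by have := is_diff_pair (differentiableP da) (differentiableP df).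
exact: (is_diff_comp dp db).
Qed.

Lemma derive_comp V W X (g : X -> V) (f : V -> W) (x v : X) :
  differentiable g x -> differentiable f (g x) ->
  'D_v (f \o g) x = 'd f (g x) ('D_v g x).
Proof.
move=> dg df.
have dfg : differentiable (f \o g) x by exact: differentiable_comp.
by rewrite (deriveE v dfg) (deriveE v dg) diff_comp.
Qed.

Lemma derive_scale V W (a : V -> R) (f : V -> W) (x v : V) :
  differentiable a x -> differentiable f x ->
  'D_v (fun y => a y *: f y) x = a x *: 'D_v f x + 'D_v a x *: f x.
Proof.
move=> da df; have H := is_diff_scale da df.
by rewrite (deriveE v da) (deriveE v df) deriveE // diff_val.
Qed.

Lemma derive_pair V W X (f : X -> V) (g : X -> W) (x v : X) :
  differentiable f x -> differentiable g x ->
  'D_v (fun y => (f y, g y)) x = ('D_v f x, 'D_v g x).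
Proof.
move=> df dg; have dfg := differentiable_pair df dg.
by rewrite (deriveE v df) (deriveE v dg) (deriveE v dfg) diff_pair.
Qed.

Lemma derive_linear_comp V W X (l : {linear V -> W}) (f : X -> V) (x v : X) :
  continuous l -> differentiable f x -> 'D_v (l \o f) x = l ('D_v f x).
Proof.
move=> cl df; rewrite derive_comp //; last exact: linear_differentiable.
by rewrite diff_lin.
Qed.

Lemma derive_Rinv (x v : R) : x != 0 ->
  'D_v (@GRing.inv R : R -> R) x = - x^-1 * x^-1 * v :> R.
Proof.
move=> x0; rewrite deriveE; last exact: differentiable_Rinv.
by rewrite diff_Rinv //= -[LHS]/(- x ^- 2 * v) expr2 invfM !mulNr.
Qed.

End Calculus.

(** * C^k maps on open sets *)

Section SmoothCalculus.
Context {R : realType}.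
Implicit Types V W X : normedModType R.

Lemma CkS V W k (U : set V) (f : V -> W) : Ck_on k.+1 U f -> Ck_on k U f.
Proof.
elim: k f => [|k IH] f [df Df].
  by move=> x /df /differentiable_continuous.
by split=> // v; apply: IH; exact: Df.
Qed.

Lemma CkW V W k (U U' : set V) (f : V -> W) :
  U' `<=` U -> Ck_on k U f -> Ck_on k U' f.
Proof.
move=> s; elim: k f => [|k IH] f /=; first by move=> H x /s; exact: H.
by move=> [df Df]; split=> [x /s /df|v] //; exact: IH.
Qed.

Lemma Ck_ext V W k (U : set V) (f g : V -> W) : open U ->
  (forall x, U x -> f x = g x) -> Ck_on k U f -> Ck_on k U g.
Proof.
move=> oU; elim: k f g => [|k IH] f g fg /=.
  move=> cf x Ux; have fgx : {near x, f =1 g}.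
    by apply: filterS (open_nbhs_nbhs (conj oU Ux)) => y; exact: fg.
  rewrite /prop_for /continuous_at -(fg _ Ux).
  by apply: cvg_trans (cf _ Ux); exact: near_eq_cvg.
have fgx x : U x -> {near x, f =1 g}.
  by move=> Ux; apply: filterS (open_nbhs_nbhs (conj oU Ux)) => y; exact: fg.
move=> [df Df]; split=> [x Ux|v].
  exact: near_eq_differentiable (fgx _ Ux) (df _ Ux).
by apply: IH (Df v) => x Ux; exact/near_eq_derive/fgx.
Qed.

Lemma Ck_cst V W k (U : set V) (w : W) : Ck_on k U (cst w).
Proof.
elim: k w => [|k IH] w /=; first by move=> x _; exact: cvg_cst.
split=> [x _|v]; first exact: differentiable_cst.
rewrite (_ : (fun x => 'D_v (cst w) x) = cst 0) //.
by apply/funext => x; rewrite derive_cst.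
Qed.

Lemma Ck_add V W k (U : set V) (f g : V -> W) : open U ->
  Ck_on k U f -> Ck_on k U g -> Ck_on k U (f \+ g).
Proof.
move=> oU; elim: k f g => [|k IH] f g /=.
  by move=> cf cg x Ux; apply: cvgD; [exact: cf|exact: cg].
move=> [df Df] [dg Dg]; split=> [x Ux|v].
  by apply: differentiableD; [exact: df|exact: dg].
apply: Ck_ext (IH _ _ (Df v) (Dg v)) => // x Ux /=.
rewrite -[f \+ g]/(f + g) deriveD //; apply: diff_derivable.
  exact: df.
exact: dg.
Qed.

Lemma Ck_sum V W k (U : set V) (J : finType) (f : J -> V -> W) : open U ->
  (forall i, Ck_on k U (f i)) -> Ck_on k U (fun x => \sum_i f i x).
Proof.
move=> oU H; elim: (index_enum J) => [|i r IH].
  by apply: (Ck_ext oU _ (Ck_cst k U 0)) => x _; rewrite big_nil.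
by apply: (Ck_ext oU _ (Ck_add oU (H i) IH)) => x _; rewrite big_cons.
Qed.

Lemma Ck_linear_comp V W X k (U : set V) (l : {linear W -> X}) (f : V -> W) :
  open U -> continuous l -> Ck_on k U f -> Ck_on k U (l \o f).
Proof.
move=> oU cl; elim: k f => [|k IH] f /=.
  by move=> cf x Ux; apply: continuous_comp; [exact: cf|exact: cl].
move=> [df Df]; split=> [x Ux|v].
  by apply: differentiable_comp; [exact: df|exact: linear_differentiable].
apply: Ck_ext (IH _ (Df v)) => // x Ux /=.
by rewrite derive_linear_comp //; exact: df.
Qed.

Lemma Ck_scale V W k (U : set V) (a : V -> R) (f : V -> W) : open U ->
  Ck_on k U a -> Ck_on k U f -> Ck_on k U (fun x => a x *: f x).
Proof.
move=> oU; elim: k a f => [|k IH] a f.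
  by move=> ca cf x Ux; apply: continuousZ; [exact: ca|exact: cf].
move=> Ca Cf; have [da Da] := Ca; have [df Df] := Cf; split=> [x Ux|v].
  by have := is_diff_scale (da _ Ux) (df _ Ux).
apply: (Ck_ext oU _
  (Ck_add oU (IH _ _ (CkS Ca) (Df v)) (IH _ _ (Da v) (CkS Cf)))) => x Ux /=.
by rewrite derive_scale //; [exact: da|exact: df].
Qed.

(** Finite dimension, as a finite family of continuous coordinate functionals
    [c] with vectors [b] that reconstruct every vector.  The index is any finite
    type, so that products of spaces get the sum of the index types. *)
Definition finite_coordinates V :=
  exists (J : finType) (c : J -> {linear V -> R}) (b : J -> V),
    (forall i, continuous (c i)) /\ forall v, v = \sum_i c i v *: b i.

(** By induction on [k].  The derivative of [f \o g] is the differential of [f]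
    applied to the moving direction ['D_v g x], whereas [Ck_on] speaks only of
    derivatives of [f] in fixed directions; coordinates on the middle space
    turn the former into a finite sum of the latter with scalar coefficients
    of class C^k. *)
Lemma Ck_comp V W X k (U : set X) (U' : set V) (g : X -> V) (f : V -> W) :
  finite_coordinates V -> open U -> (forall x, U x -> U' (g x)) ->
  Ck_on k U g -> Ck_on k U' f -> Ck_on k U (f \o g).
Proof.
move=> [J [c [b [cc cb]]]] oU UU'; elim: k f => [|k IH] f Cg.
  move=> cf x Ux; apply: continuous_comp; first exact: Cg.
  by apply: cf; exact: UU'.
have [dg Dg] := Cg; move=> [df Df]; split=> [x Ux|v].
  by apply: differentiable_comp; [exact: dg|apply: df; exact: UU'].
have H i : Ck_on k U (fun x => c i ('D_v g x) *: 'D_(b i) f (g x)).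
  apply: (Ck_scale oU); first exact: (Ck_linear_comp oU (cc i) (Dg v)).
  exact: IH (CkS Cg) (Df (b i)).
apply: (Ck_ext oU _ (Ck_sum oU H)) => x Ux.
have dfg := df _ (UU' _ Ux).
rewrite derive_comp //; last exact: dg.
rewrite [in RHS](cb ('D_v g x)) linear_sum; apply: eq_bigr => i _.
by rewrite linearZ (deriveE (b i) dfg).
Qed.

Lemma Ck_linear V W k (U : set V) (l : {linear V -> W}) :
  continuous l -> Ck_on k U l.
Proof.
move=> cl; case: k => [|k]; first by move=> x _; exact: cl.
split=> [x _|v]; first exact: linear_differentiable.
rewrite (_ : (fun x => 'D_v l x) = cst (l v)); first exact: Ck_cst.
apply/funext => x.
by rewrite deriveE ?diff_lin //; exact: linear_differentiable.
Qed.

End SmoothCalculus.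

(** * Coordinates, pairs and inverses *)

Section Coordinates.
Context {R : realType}.
Implicit Types V W X : normedModType R.

Definition fst_linear V W : {linear (V * W)%type -> V} := fst.
Definition snd_linear V W : {linear (V * W)%type -> W} := snd.

Lemma fst_linear_continuous V W : continuous (fst_linear V W).
Proof. by move=> x; exact: cvg_fst. Qed.

Lemma snd_linear_continuous V W : continuous (snd_linear V W).
Proof. by move=> x; exact: cvg_snd. Qed.

Lemma pair0_is_linear V W : linear (fun v : V => (v, 0 : W)).
Proof. by move=> a u v; congr pair; rewrite /= scaler0 addr0. Qed.

Lemma pair0l_is_linear V W : linear (fun w : W => (0 : V, w)).
Proof. by move=> a u v; congr pair; rewrite /= scaler0 addr0. Qed.

Definition inl_linear V W : {linear V -> (V * W)%type} :=
  HB.pack (fun v : V => (v, 0 : W))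
    (GRing.isLinear.Build _ _ _ _ _ (@pair0_is_linear V W)).
Definition inr_linear V W : {linear W -> (V * W)%type} :=
  HB.pack (fun w : W => (0 : V, w))
    (GRing.isLinear.Build _ _ _ _ _ (@pair0l_is_linear V W)).

Lemma inl_linear_continuous V W : continuous (inl_linear V W).
Proof. by move=> x; apply: cvg_pair; [exact: cvg_id|exact: cvg_cst]. Qed.

Lemma inr_linear_continuous V W : continuous (inr_linear V W).
Proof. by move=> x; apply: cvg_pair; [exact: cvg_cst|exact: cvg_id]. Qed.

(** A pair is the sum of its two components, each composed with the linear
    inclusion of a factor. *)
Lemma Ck_pair V W X k (U : set X) (f : X -> V) (g : X -> W) : open U ->
  Ck_on k U f -> Ck_on k U g -> Ck_on k U (fun x => (f x, g x)).
Proof.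
move=> oU Cf Cg; have := Ck_add oU
  (Ck_linear_comp oU (@inl_linear_continuous V W) Cf)
  (Ck_linear_comp oU (@inr_linear_continuous V W) Cg).
by apply: Ck_ext => // x _; congr pair; rewrite /= ?addr0 ?add0r.
Qed.

Lemma Ck_fst V W k (U : set (V * W)) : Ck_on k U fst.
Proof. exact: (Ck_linear _ _ (@fst_linear_continuous V W)). Qed.

Lemma Ck_snd V W k (U : set (V * W)) : Ck_on k U snd.
Proof. exact: (Ck_linear _ _ (@snd_linear_continuous V W)). Qed.

Lemma finite_coordinates_real : finite_coordinates R.
Proof.
exists unit, (fun=> idfun : {linear R -> R}), (fun=> 1); split=> [_ x|v].
  exact: cvg_id.
by rewrite big_const card_unit /= addr0 [RHS]mulr1.
Qed.

Lemma finite_coordinates_row n : finite_coordinates 'rV[R]_n.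
Proof.
have L (j : 'I_n) : linear (fun v : 'rV[R]_n => v ord0 j : R).
  by move=> a u v; rewrite !mxE.
pose c (j : 'I_n) : {linear 'rV[R]_n -> R} :=
  HB.pack (fun v : 'rV[R]_n => v ord0 j) (GRing.isLinear.Build _ _ _ _ _ (L j)).
exists 'I_n, c, (fun j => delta_mx 0 j); split=> [j|v].
  exact: coord_continuous.
exact: row_sum_delta.
Qed.

Lemma finite_coordinates_prod V W : finite_coordinates V ->
  finite_coordinates W -> finite_coordinates (V * W)%type.
Proof.
move=> [J [c [b [cc cb]]]] [J' [c' [b' [cc' cb']]]].
exists (J + J')%type.
exists (fun j => match j with
  | inl i => (c i \o fst_linear V W) : {linear (V * W)%type -> R}
  | inr i => (c' i \o snd_linear V W) : {linear (V * W)%type -> R} end).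
exists (fun j => match j with
  | inl i => inl_linear V W (b i)
  | inr i => inr_linear V W (b' i) end); split=> [[i|i] x|[v w]].
- by apply: continuous_comp; [exact: cvg_fst|exact: cc].
- by apply: continuous_comp; [exact: cvg_snd|exact: cc'].
rewrite big_sumType /=.
have E1 : \sum_i c i v *: ((b i, 0) : V * W) = inl_linear V W v.
  by rewrite [in RHS](cb v) linear_sum; apply: eq_bigr => i _; rewrite linearZ.
have E2 : \sum_i c' i w *: ((0, b' i) : V * W) = inr_linear V W w.
  by rewrite [in RHS](cb' w) linear_sum; apply: eq_bigr => i _; rewrite linearZ.
by rewrite E1 E2; congr pair; rewrite /= ?addr0 ?add0r.
Qed.

(** By induction on [k], since the derivative of the inverse is a product of
    copies of the inverse. *)
Lemma Ck_inv k : Ck_on k [set x : R | x != 0] (@GRing.inv R : R -> R).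
Proof.
have oU : open [set x : R | x != 0].
  rewrite (_ : mkset _ = ~` [set 0]); last by apply/seteqP; split => x /eqP.
  by rewrite openC; exact: closed_eq.
elim: k => [|k IH]; first by move=> x /= x0; exact: inv_continuous.
split=> [x x0|v]; first exact: differentiable_Rinv.
have CN : Ck_on k [set x : R | x != 0] (fun x : R => (- v) *: x^-1 : R).
  exact: (Ck_scale oU (Ck_cst _ _ _) IH).
apply: (Ck_ext oU _ (Ck_scale oU CN IH)) => x /= x0.
rewrite derive_Rinv // -[LHS]/((- v * x^-1) * x^-1).
by rewrite !mulNr -mulrA [v * _]mulrC.
Qed.

Lemma open_setI_preimage (T T' : topologicalType) (U : set T) (U' : set T')
    (g : T -> T') :
  open U -> open U' -> (forall x, U x -> {for x, continuous g}) ->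
  open (U `&` g @^-1` U').
Proof.
move=> oU oU' cg; rewrite openE => x [Ux U'gx]; apply: filterI.
  exact: open_nbhs_nbhs.
by apply: (cg x Ux); exact: open_nbhs_nbhs.
Qed.

End Coordinates.

(** * Symmetry of second derivatives *)

Section Schwarz.
Context {R : realType} {V : normedModType R}.
Implicit Types W : normedModType R.

Lemma is_derive_line W (f : V -> W) (u z : V) (s : R) :
  derivable f (s *: u + z) u ->
  is_derive s 1 (fun t : R => f (t *: u + z)) ('D_u f (s *: u + z)).
Proof.
move=> df.
have E : (fun h : R => h^-1 *:
      (((fun t : R => f (t *: u + z)) \o shift s) (h *: 1) - f (s *: u + z))) =
    (fun h : R => h^-1 *:
      ((f \o shift (s *: u + z)) (h *: u) - f (s *: u + z))).
  apply/funext => h /=; congr (_ *: (f _ - _)).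
  by rewrite [h *: 1]mulr1 scalerDl addrA.
by apply: DeriveDef; rewrite /derivable /derive E.
Qed.

Lemma mvt_line (f : V -> R) (u z : V) (h : R) : 0 < h ->
  (forall s : R, 0 <= s <= h -> derivable f (s *: u + z) u) ->
  exists2 s, 0 <= s <= h & f (h *: u + z) - f z = h * 'D_u f (s *: u + z).
Proof.
move=> h0 df.
have D s : 0 <= s <= h ->
    is_derive s 1 (fun t : R => f (t *: u + z)) ('D_u f (s *: u + z)).
  by move=> sh; apply: is_derive_line; exact: df.
have [s||s sh] := @MVT_segment R (fun t => f (t *: u + z))
    (fun s => 'D_u f (s *: u + z)) 0 h (ltW h0).
- by rewrite in_itv /= => /andP[s0 sh]; apply: D; rewrite !ltW.
- by apply: derivable_within_continuous => s; rewrite in_itv /= => /D[].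
- by rewrite scale0r add0r subr0 mulrC => E; exists s.
Qed.

(** The mean value theorem, first along [u] for the difference of two
    translates of [f] and then along [v] for ['D_u f], expresses the second
    difference of [f] on a small parallelogram by one value of the mixed
    derivative. *)
Lemma mixed_difference (f : V -> R) (x u v : V) (P : set V) :
  nbhs x P ->
  (forall y, P y -> derivable f y u /\ derivable (fun z => 'D_u f z) y v) ->
  exists2 e : R, 0 < e & forall h, 0 < h < e -> exists2 y, P y &
    f (h *: u + (h *: v + x)) - f (h *: v + x) - (f (h *: u + x) - f x)
    = h * (h * 'D_v (fun z => 'D_u f z) y).
Proof.
move=> xP dP.
pose m (p : R * R) := p.1 *: u + (p.2 *: v + x).
have cm : {for ((0, 0) : R * R), continuous m}.
  apply: cvgD; first by apply: cvgZr_tmp; exact: cvg_fst.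
  apply: cvgD; last exact: cvg_cst.
  by apply: cvgZr_tmp; exact: cvg_snd.
have /nbhs_ballP[e /= e0 He] : nbhs ((0, 0) : R * R) (m @^-1` P).
  by apply: cm; rewrite /m /= !scale0r !add0r.
exists e => // h /andP[h0 he].
have Hm s t : 0 <= s <= h -> 0 <= t <= h -> P (s *: u + (t *: v + x)).
  move=> /andP[s0 sh] /andP[t0 th]; apply: (He (s, t)).
  by split; rewrite /ball /= sub0r normrN ger0_norm // (le_lt_trans _ he).
have hh : 0 <= h <= h by rewrite lexx ltW.
have h00 : 0 <= (0 : R) <= h by rewrite lexx ltW.
pose g z := f (h *: v + z) - f z.
have dg (s : R) : 0 <= s <= h ->
    is_derive (s *: u + x) u g
      ('D_u f (h *: v + (s *: u + x)) - 'D_u f (s *: u + x)).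
  move=> sh.
  have [d1 _] := dP _ (Hm _ _ sh hh); have [d2 _] := dP _ (Hm _ _ sh h00).
  rewrite scale0r add0r in d2; rewrite addrCA in d1.
  (* Translation by [h *: v] commutes with taking difference quotients. *)
  have Equot : (fun k : R => k^-1 *:
        (((fun z => f (h *: v + z)) \o shift (s *: u + x)) (k *: u) -
         f (h *: v + (s *: u + x)))) =
      (fun k : R => k^-1 *:
        ((f \o shift (h *: v + (s *: u + x))) (k *: u) -
         f (h *: v + (s *: u + x)))).
    by apply/funext => k /=; rewrite addrCA.
  have E1 : 'D_u (fun z => f (h *: v + z)) (s *: u + x) =
      'D_u f (h *: v + (s *: u + x)) by rewrite /derive Equot.
  have E2 : derivable (fun z => f (h *: v + z)) (s *: u + x) u.
    by rewrite /derivable Equot.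
  apply: DeriveDef; first exact: derivableB.
  by rewrite deriveB // E1.
have dg' s : 0 <= s <= h -> derivable g (s *: u + x) u by move=> /dg[].
have [s sh Es] := mvt_line h0 dg'.
have [t th Et] : exists2 t, 0 <= t <= h &
    'D_u f (h *: v + (s *: u + x)) - 'D_u f (s *: u + x) =
    h * 'D_v (fun z => 'D_u f z) (t *: v + (s *: u + x)).
  apply: mvt_line => // t th; rewrite addrCA.
  by have [] := dP _ (Hm _ _ sh th).
exists (t *: v + (s *: u + x)); first by rewrite addrCA; exact: Hm.
rewrite -Et -(@derive_val _ _ _ _ _ _ _ (dg s sh)) -Es /g.
rewrite (addrCA (h *: v)) !opprB addrACA [RHS]addrACA.
by rewrite (addrC (- f _) (- f _)).
Qed.

(** Schwarz's theorem.  The second difference of [f] on the parallelogram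
    spanned by [h *: u] and [h *: v] is symmetric in [u] and [v]; divided by
    [h ^ 2] it is a value, near [x], of either mixed derivative, and both are
    continuous at [x]. *)
Lemma derive_comm (U : set V) (f : V -> R) (x u v : V) :
  open U -> Ck_on 2 U f -> U x ->
  'D_u (fun z => 'D_v f z) x = 'D_v (fun z => 'D_u f z) x.
Proof.
move=> oU [df Df] Ux.
have half (a b : V) (e : R) : 0 < e ->
    exists2 d : R, 0 < d & forall h, 0 < h < d ->
    exists2 y, `|'D_b (fun z => 'D_a f z) x - y| < e &
    f (h *: a + (h *: b + x)) - f (h *: b + x) - (f (h *: a + x) - f x) =
    h * (h * y).
  move=> e0; have [da Da] := Df a; have cDab := Da b x Ux.
  pose P := U `&` [set y |
    `|'D_b (fun z => 'D_a f z) x - 'D_b (fun z => 'D_a f z) y| < e].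
  have xP : nbhs x P.
    apply: filterI; first exact: open_nbhs_nbhs.
    by move/cvgrPdist_lt : cDab; apply.
  have [|d d0 H] := @mixed_difference f x a b P xP.
    by move=> y [Uy _]; split; apply: diff_derivable; [exact: df|exact: da].
  by exists d => // h /H[y [_ Py] Ey]; exists ('D_b (fun z => 'D_a f z) y).
apply/eqP; rewrite -subr_eq0 -normr_le0.
apply/ler_addgt0Pr => e e0; rewrite add0r.
have e2 : 0 < e / 2 by rewrite divr_gt0.
have [d1 d10 H1] := half v u _ e2.
have [d2 d20 H2] := half u v _ e2.
pose h := Num.min d1 d2 / 2.
have m0 : 0 < Num.min d1 d2 by rewrite lt_min d10.
have h0 : 0 < h by rewrite divr_gt0.
have hm : h < Num.min d1 d2 by rewrite ltr_pdivrMr // ltr_pMr // ltr1n.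
move: hm; rewrite lt_min => /andP[hd1 hd2].
have [|y1 Y1 E1] := H1 h; first by rewrite h0.
have [|y2 Y2 E2] := H2 h; first by rewrite h0.
(* Both are the same second difference divided by [h * h]. *)
have y12 : y1 = y2.
  apply: (mulfI (lt0r_neq0 h0)); apply: (mulfI (lt0r_neq0 h0)).
  rewrite -E1 -E2 (addrCA (h *: u)) !opprB addrACA [RHS]addrACA.
  by rewrite (addrC (- f _) (- f _)).
rewrite y12 in Y1; rewrite (splitr e) -(subrKA y2).
apply/ltW/(le_lt_trans (ler_normD _ _))/ltrD; first exact: Y1.
by rewrite distrC; exact: Y2.
Qed.

End Schwarz.

(** * Change of the time variable in the action *)

Section Substitution.
Context {R : realType}.
Implicit Types (a b t : R) (F G : R -> R).

Local Notation mu := (@lebesgue_measure R).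

(** Also when [a = b]: a one-point segment carries no mass. *)
Lemma oriented_integralC a b G :
  oriented_integral b a G = - oriented_integral a b G.
Proof.
rewrite /oriented_integral; case: (ltgtP a b) => [_|_|->]; rewrite ?opprK //.
by rewrite set_itv1 Rintegral_set1 oppr0.
Qed.

Lemma continuous_within a b G :
  (forall t, a <= t <= b -> {for t, continuous G}) ->
  {within `[a, b], continuous G}.
Proof.
move=> cG; apply: continuous_in_subspaceT => t; rewrite inE /= in_itv /=.
exact: cG.
Qed.

Section IncreasingChange.
Variables (a b : R) (F : R -> R).
Hypothesis ab : a <= b.
Hypothesis dF : forall t, a <= t <= b -> derivable F t 1.
Hypothesis cF' : forall t, a <= t <= b -> {for t, continuous (derive1 F)}.
Hypothesis F'gt0 : forall t, a <= t <= b -> 0 < derive1 F t.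

Let cF t : a <= t <= b -> {for t, continuous F}.
Proof. by move=> /dF /derivable1_diffP /differentiable_continuous. Qed.

Let wF : {within `[a, b], continuous F}.
Proof. exact: continuous_within. Qed.

Let aab : a <= a <= b. Proof. by rewrite lexx. Qed.
Let bab : a <= b <= b. Proof. by rewrite lexx andbT. Qed.

Let ooP t : t \in `]a, b[ -> a <= t <= b.
Proof. by rewrite in_itv /= => /andP[/ltW -> /ltW ->]. Qed.

Lemma pos_derive_increasing : {in `[a, b] &, {homo F : x y / x < y}}.
Proof.
apply: gtr0_derive1_lt_cc => // t /ooP; [exact: dF|exact: F'gt0].
Qed.

Lemma increasing_image s : F a <= s <= F b -> exists2 t, a <= t <= b & F t = s.
Proof.
move=> /andP[as_ sb]; have [||t] := @IVT R F a b s ab => //.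
  apply/andP; split; first by rewrite ge_min as_.
  by rewrite le_max sb orbT.
by rewrite in_itv /= => tab Ft; exists t.
Qed.

Lemma Rintegral_substitution G :
  {within `[F a, F b], continuous G} ->
  \int[mu]_(s in `[F a, F b]) G s =
  \int[mu]_(t in `[a, b]) (G (F t) * derive1 F t).
Proof.
move=> cG; rewrite /Rintegral (integration_by_substitution_increasing ab) //.
- exact: pos_derive_increasing.
- by move=> t /ooP; exact: cF'.
- by apply/cvg_ex; exists (derive1 F a); apply: cvg_at_right_filter; exact: cF'.
- by apply/cvg_ex; exists (derive1 F b); apply: cvg_at_left_filter; exact: cF'.
- split; first by move=> t /ooP; exact: dF.
    by apply: cvg_at_right_filter; exact: cF.
  by apply: cvg_at_left_filter; exact: cF.
Qed.

Lemma action_change n (L : R * 'rV[R]_n * 'rV[R]_n -> R) (p : R -> 'rV[R]_n) :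
  (forall t, a <= t <= b ->
     {for F t, continuous (fun s => L (s, p s, derive1 p s))}) ->
  action L (F a) (F b) p =
  \int[mu]_(t in `[a, b]) (L (F t, p (F t), derive1 p (F t)) * derive1 F t).
Proof.
move=> cL; rewrite /action /oriented_integral.
have Fab : F a <= F b.
  move: ab; rewrite le_eqVlt => /predU1P[->//|ltab]; apply/ltW.
  by apply: pos_derive_increasing => //; rewrite in_itv.
rewrite Fab Rintegral_substitution //.
by apply: continuous_within => s /increasing_image[t tab <-]; exact: cL.
Qed.

Section Inverse.
Variable d : R.
Let g := 'pinv_(fun=> d) `[a, b] F.

Let Finj : {in `[a, b] &, injective F}.
Proof.
move=> x y xab yab Fxy; apply: contraTeq isT => xy.
have [lt|lt|E] := ltgtP x y; last by rewrite E eqxx in xy.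
  by have := pos_derive_increasing xab yab lt; rewrite Fxy ltxx.
by have := pos_derive_increasing yab xab lt; rewrite Fxy ltxx.
Qed.

Let gK t : a <= t <= b -> g (F t) = t.
Proof.
move=> tab; apply: pinvKV; last by rewrite inE /= in_itv.
by move=> x y; rewrite !inE; exact: Finj.
Qed.

Let gcont : {within `[F a, F b], continuous g}.
Proof.
by apply: segment_can_le_continuous => // t; rewrite in_itv /=; exact: gK.
Qed.

Let gder t : t \in `]a, b[ -> is_derive (F t) 1 g (derive1 F t)^-1.
Proof.
move=> tab.
have nab : \forall s \near t, s \in `]a, b[ by exact: near_in_itvoo.
apply: is_derive_inverse.
- by apply: filterS nab => s /ooP; exact: gK.
- by apply: filterS nab => s /ooP; exact: cF.
- by rewrite derive1E; apply/derivableP/dF/ooP.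
- by rewrite gt_eqF // F'gt0 // ooP.
Qed.

(** The velocity of [Q \o g] at time [F t] is [derive1 Q t / derive1 F t], and
    the substitution [s = F t] then removes [g] altogether.  At the two ends of
    [[F a, F b]] the function [g], extended by the dummy [d], need not be
    derivable; there the integrand may differ from the function of [g s] that
    describes it inside, without effect on the integral. *)
Lemma action_inverse_change n (L : R * 'rV[R]_n * 'rV[R]_n -> R)
    (Q : R -> 'rV[R]_n) :
  (forall t, a <= t <= b -> differentiable Q t) ->
  (forall t, a <= t <= b ->
     {for t, continuous
       (fun t => L (F t, Q t, (derive1 F t)^-1 *: derive1 Q t))}) ->
  action L (F a) (F b) (Q \o g) =
  \int[mu]_(t in `[a, b])
    (L (F t, Q t, (derive1 F t)^-1 *: derive1 Q t) * derive1 F t).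
Proof.
move=> dQ cL; rewrite /action /oriented_integral.
have Fab : F a <= F b.
  move: ab; rewrite le_eqVlt => /predU1P[->//|ltab]; apply/ltW.
  by apply: pos_derive_increasing => //; rewrite in_itv.
rewrite Fab.
pose H t := L (F t, Q t, (derive1 F t)^-1 *: derive1 Q t).
have wH : {within `[F a, F b], continuous (H \o g)}.
  rewrite continuous_subspace_in => s /set_mem /=; rewrite in_itv /=.
  move=> /increasing_image[t tab Fts].
  apply: (@continuous_comp (subspace `[F a, F b]) _ _ g H s).
    exact: gcont.
  by rewrite -Fts gK //; exact: cL.
transitivity (\int[mu]_(s in `[F a, F b]) (H \o g) s).
  have oo : {in `]F a, F b[,
      (fun s => L (s, Q (g s), derive1 (Q \o g) s)) =1 H \o g}.
    move=> s; rewrite in_itv /= => /andP[as_ sb].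
    have [t tab Fts] : exists2 t, a <= t <= b & F t = s.
      by apply: increasing_image; rewrite !ltW.
    have toab : t \in `]a, b[.
      rewrite in_itv /= !lt_neqAle; have /andP[-> ->] := tab; rewrite !andbT.
      by apply/andP; split; apply/eqP => E; move: as_ sb; rewrite -Fts E ltxx.
    have Dg := gder toab; rewrite -Fts /H /= gK //; congr (L (_, _, _)).
    have dgt : differentiable g (F t) by apply/derivable1_diffP; case: Dg.
    have dQt : differentiable Q (g (F t)) by rewrite gK //; exact: dQ.
    rewrite !derive1E (derive_comp _ dgt dQt) gK // derive_val.
    rewrite (deriveE _ (dQ _ tab)) -derive1E -linearZ.
    by congr ('d Q t _); rewrite [RHS]mulr1.
  have mH : measurable_fun `]F a, F b[ (H \o g).
    have : measurable_fun `[F a, F b] (H \o g).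
      exact: measurable_realfun.subspace_continuous_measurable_fun.
    by apply: measurable_funS => //; exact: subset_itv_oo_cc.
  congr fine; apply: eq_integral_itv_bounded => //.
  apply: eq_measurable_fun mH => s sab; apply/esym/oo.
  by rewrite inE in sab.
etransitivity; first exact: Rintegral_substitution wH.
apply: eq_Rintegral => t.
by rewrite inE /= in_itv /= => tab; rewrite gK.
Qed.

End Inverse.

End IncreasingChange.
End Substitution.

(** * Families depending on [eps] and [t] *)

Section Families.
Context {R : realType}.
Implicit Types (V W : normedModType R) (N : set (R * R)).

Definition d_eps W (f : R * R -> W) (x : R * R) : W := 'D_((1, 0) : R * R) f x.
Definition d_time W (f : R * R -> W) (x : R * R) : W := 'D_((0, 1) : R * R) f x.

Lemma derive1_time W (f : R * R -> W) (e : R) :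
  derive1 (fun t => f (e, t)) = fun t => d_time f (e, t).
Proof.
apply/funext => t; rewrite /derive1 /d_time /derive.
suff -> : (fun h => h^-1 *: (f (e, h + t) - f (e, t))) = (fun h : R =>
  h^-1 *: ((f \o shift (e, t)) (h *: ((0, 1) : R * R)) - f (e, t))) by [].
apply/funext => h /=; congr (_ *: (f (_, _) - _)); rewrite /= /GRing.scale /=.
  by rewrite mulr0 add0r.
by rewrite mulr1.
Qed.

Lemma derive1_eps W (f : R * R -> W) (t : R) :
  derive1 (fun e => f (e, t)) = fun e => d_eps f (e, t).
Proof.
apply/funext => e; rewrite /derive1 /d_eps /derive.
suff -> : (fun h => h^-1 *: (f (h + e, t) - f (e, t))) = (fun h : R =>
  h^-1 *: ((f \o shift (e, t)) (h *: ((1, 0) : R * R)) - f (e, t))) by [].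
apply/funext => h /=; congr (_ *: (f (_, _) - _)); rewrite /= /GRing.scale /=.
  by rewrite mulr1.
by rewrite mulr0 add0r.
Qed.

Lemma continuous_time (T : topologicalType) (f : R * R -> T) (e t : R) :
  {for (e, t), continuous f} -> {for t, continuous (fun t => f (e, t))}.
Proof.
move=> cf; have ce : (e, s) @[s --> t] --> (e, t).
  apply: (@cvg_pair _ _ _ (nbhs t) (nbhs e) (nbhs t)); first exact: cvg_cst.
  exact: cvg_id.
exact: (@continuous_comp _ _ _ (fun t => (e, t)) f t ce cf).
Qed.

Lemma differentiable_time W (f : R * R -> W) (e t : R) :
  differentiable f (e, t) -> differentiable (fun t => f (e, t)) t.
Proof.
by move=> df; exact: (@differentiable_comp _ _ _ _ (fun t => (e, t)) f).
Qed.

Lemma differentiable_fst (x : R * R) : differentiable (fst : R * R -> R) x.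
Proof.
apply: (linear_differentiable (f := fst_linear R R)).
exact: fst_linear_continuous.
Qed.

Lemma differentiable_snd (x : R * R) : differentiable (snd : R * R -> R) x.
Proof.
apply: (linear_differentiable (f := snd_linear R R)).
exact: snd_linear_continuous.
Qed.

(** The chain rule along the curve [eps |-> (eps, s (eps, t))], which starts at
    [(0, t)] with velocity [(1, d_eps s (0, t))].  Both the retiming of a family
    by a time change and the shift of its argument are of this form. *)
Lemma d_eps_reparametrized W (f : R * R -> W) (s : R * R -> R) (t : R) :
  differentiable f (0, t) -> differentiable s (0, t) -> s (0, t) = t ->
  d_eps (fun x => f (x.1, s x)) (0, t) =
  d_eps f (0, t) + d_eps s (0, t) *: d_time f (0, t).
Proof.
move=> df ds st; have dfst := differentiable_fst ((0, t) : R * R).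
pose S (x : R * R) : R * R := (x.1, s x).
have dS : differentiable S (0, t) by exact: differentiable_pair.
have S0 : S (0, t) = (0, t) by rewrite /S st.
have dfS : differentiable f (S (0, t)) by rewrite S0.
have ES : 'D_((1, 0) : R * R) S (0, t) = (1, d_eps s (0, t)).
  etransitivity; first exact: derive_pair _ dfst ds.
  congr pair; rewrite (deriveE _ dfst) (@diff_lin _ _ _ (fst_linear R R)) //.
  exact: fst_linear_continuous.
rewrite -[LHS]/('D_((1, 0) : R * R) (f \o S) (0, t)).
rewrite (derive_comp _ dS dfS) ES S0.
have -> : (1, d_eps s (0, t)) =
    ((1, 0) : R * R) + d_eps s (0, t) *: ((0, 1) : R * R).
  by congr pair; rewrite /= /GRing.scale /= ?mulr0 ?mulr1 ?addr0 ?add0r.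
by rewrite linearD linearZ -!(deriveE _ df).
Qed.

Lemma smooth_diff V W (U : set V) (f : V -> W) (x : V) :
  smooth_on U f -> U x -> differentiable f x.
Proof. by move=> /(_ 1)[df _] /df. Qed.

Lemma smooth_continuous V W (U : set V) (f : V -> W) (x : V) :
  smooth_on U f -> U x -> {for x, continuous f}.
Proof. by move=> /(_ 0); exact. Qed.

Lemma smooth_derive V W (U : set V) (f : V -> W) (v : V) :
  smooth_on U f -> smooth_on U (fun x => 'D_v f x).
Proof. by move=> sf k; have [_] := sf k.+1; exact. Qed.

(** Schwarz's theorem for vector-valued functions, one coordinate at a time. *)
Lemma derive_comm_vector V W (U : set V) (f : V -> W) (x u v : V) :
  finite_coordinates W -> open U -> smooth_on U f -> U x ->
  'D_u (fun z => 'D_v f z) x = 'D_v (fun z => 'D_u f z) x.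
Proof.
move=> [J [c [b [cc cb]]]] oU sf Ux.
have E w1 w2 i : c i ('D_w1 (fun z => 'D_w2 f z) x) =
    'D_w1 (fun z => 'D_w2 (c i \o f) z) x.
  rewrite -derive_linear_comp //; last first.
    exact: smooth_diff (smooth_derive w2 sf) Ux.
  apply: near_eq_derive; apply: filterS (open_nbhs_nbhs (conj oU Ux)) => y Uy.
  by rewrite /= derive_linear_comp //; exact: smooth_diff sf Uy.
rewrite [LHS]cb [RHS]cb; apply: eq_bigr => i _; congr (_ *: _).
rewrite !E; apply: (derive_comm _ _ oU) => //.
by apply: Ck_linear_comp => //; exact: sf.
Qed.

Lemma is_derive0_of_little_o (D : R -> R) :
  (forall eta : R, 0 < eta -> \forall e \near (0 : R), `|D e| <= eta * `|e|) ->
  is_derive (0 : R) 1 D 0.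
Proof.
move=> H.
have D0 : D 0 = 0.
  by have /nbhs_singleton := H 1 ltr01; rewrite normr0 mulr0 normr_le0 => /eqP.
suff C : (fun h : R => h^-1 *: ((D \o shift 0) (h *: 1) - D 0)) @ 0^' -->
    (0 : R).
  by apply: DeriveDef; [apply/cvg_ex; exists 0|exact: cvg_lim C].
apply/cvgrPdist_le => eta eta0; have := H eta eta0.
move/(@cvg_within _ _ _ (fun x => x != 0)).
rewrite /=; near_simpl => K; near=> h.
have h0 : h != 0 by near: h; exact: nbhs_dnbhs_neq.
rewrite sub0r normrN D0 subr0 addr0 [h *: 1]mulr1 normrZ normfV.
by rewrite mulrC ler_pdivrMr ?normr_gt0 //; near: h.
Unshelve. all: by end_near. Qed.
(** The tube lemma around [{0} x [a, b]]. *)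
Lemma near_segment (A : R * R -> Prop) (a b : R) :
  (forall t, a <= t <= b -> \forall x \near ((0, t) : R * R), A x) ->
  \forall e \near (0 : R), forall t, a <= t <= b -> A (e, t).
Proof.
move=> nearA.
have cov : near_covering `[a, b].
  by apply/compact_near_coveringP; exact: segment_compact.
have : \forall e \near (0 : R), `[a, b] `<=` (fun t => A (e, t)).
  apply: (cov R (nbhs (0 : R)) (fun e t => A (e, t))) => t.
  rewrite /= in_itv /= => /nearA[[B C] /= [B0 Ct] BC].
  by exists (C, B) => // -[x e] /= [Cx Be]; exact: (BC (e, x)).
by apply: filterS => e H t tab; apply: H; rewrite /= in_itv.
Qed.

(** By compactness the derivative in [eps] stays small on a whole strip around
    [{0} x [a, b]], and the mean value theorem bounds [h] there. *)
Lemma uniformly_little_o N (h : R * R -> R) (a b : R) : open N ->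
  Ck_on 1 N h ->
  (forall t, a <= t <= b -> [/\ N (0, t), h (0, t) = 0 & d_eps h (0, t) = 0]) ->
  forall eta : R, 0 < eta -> \forall e \near (0 : R),
    forall t, a <= t <= b -> `|h (e, t)| <= eta * `|e|.
Proof.
move=> oN [dh Dh] h0 eta eta0.
pose good x := N x /\ `|d_eps h x| < eta.
have /nbhs_ballP[d /= d0 Hd] : \forall e \near (0 : R),
    forall t, a <= t <= b -> good (e, t).
  apply: near_segment => t tab; have [N0 _ h't0] := h0 t tab.
  have c : {for (0, t), continuous (fun x => d_eps h x)} by exact: Dh.
  apply: filterI; first exact: open_nbhs_nbhs.
  move/cvgrPdist_lt : c => /(_ _ eta0); rewrite h't0.
  by apply: filterS => x; rewrite sub0r normrN.
apply/nbhs_ballP; exists d => //= e ed t tab.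
have G s : 0 <= s <= 1 -> good (s * e, t).
  move=> /andP[s0 s1]; apply: Hd => //.
  move: ed; rewrite /ball /= !sub0r !normrN normrM (ger0_norm s0).
  by apply: le_lt_trans; rewrite ler_piMl.
have Es s : s *: ((e, 0) : R * R) + (0, t) = (s * e, t).
  by congr pair; rewrite /= /GRing.scale /= ?addr0 // mulr0 add0r.
(* The direction [(e, 0)] carries the sign of [e]. *)
have [s s01] : exists2 s, 0 <= s <= 1 &
    h (1 *: ((e, 0) : R * R) + (0, t)) - h (0, t) =
    1 * 'D_((e, 0) : R * R) h (s *: ((e, 0) : R * R) + (0, t)).
  apply: mvt_line => // s /G[Ns _]; rewrite Es.
  by apply: diff_derivable; exact: dh.
have [_ -> _] := h0 t tab; rewrite !Es mul1r subr0 mul1r => ->.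
have [Ns ds] := G s s01.
have -> : ((e, 0) : R * R) = e *: ((1, 0) : R * R).
  by congr pair; rewrite /= /GRing.scale /= ?mulr0 // mulr1.
rewrite (deriveE _ (dh _ Ns)) linearZ -(deriveE _ (dh _ Ns)) normrZ mulrC.
by rewrite ler_wpM2r // ltW.
Qed.

End Families.

(** * Equivalence of the two invariances *)

Section FirstOrder.
Context {R : realType} (n : nat).
Variables (U : set (R * 'rV[R]_n * 'rV[R]_n)).
Variables (L : R * 'rV[R]_n * 'rV[R]_n -> R).
Variables (I : set R) (q : R -> 'rV[R]_n).
Hypothesis openU : open U.
Hypothesis smoothL : smooth_on U L.
Hypothesis open_I : open I.
Hypothesis itvI : is_interval I.
Hypothesis smoothq : smooth_on I q.
Hypothesis domq : forall t, I t -> U (t, q t, derive1 q t).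

Local Notation mu := (@lebesgue_measure R).

Lemma finite_coordinates_plane : finite_coordinates (R * R)%type.
Proof. by apply: finite_coordinates_prod; exact: finite_coordinates_real. Qed.

Lemma finite_coordinates_phase :
  finite_coordinates (R * 'rV[R]_n * 'rV[R]_n)%type.
Proof.
apply: finite_coordinates_prod; last exact: finite_coordinates_row.
apply: finite_coordinates_prod; first exact: finite_coordinates_real.
exact: finite_coordinates_row.
Qed.

(** At [eps = 0] a family may be replaced by its initial trajectory before
    differentiating in time, because [I] is open. *)
Lemma d_time_initial (W : normedModType R) (f : R * R -> W) (g : R -> W)
    (t : R) :
  (forall s, I s -> f (0, s) = g s) -> I t -> d_time f (0, t) = derive1 g t.
Proof.
move=> fg It; have /(congr1 (fun F => F t)) <- := derive1_time f 0.
rewrite !derive1E; apply: near_eq_derive.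
by apply: filterS (open_nbhs_nbhs (conj open_I It)) => s; exact: fg.
Qed.

Lemma Rintegral_bound (h : R -> R) (a b M : R) : a <= b ->
  (forall t, a <= t <= b -> {for t, continuous h}) ->
  (forall t, a <= t <= b -> `|h t| <= M) ->
  `|\int[mu]_(t in `[a, b]) h t| <= M * (b - a).
Proof.
move=> ab ch hM.
have ih : mu.-integrable `[a, b] (EFin \o h).
  apply: continuous_compact_integrable; first exact: segment_compact.
  exact: continuous_within.
have ic : mu.-integrable `[a, b] (EFin \o cst M).
  apply: continuous_compact_integrable; first exact: segment_compact.
  by apply: continuous_within => t _; exact: cvg_cst.
apply: le_trans (le_normr_Rintegral _ ih) _ => //.
have -> : M * (b - a) = \int[mu]_(t in `[a, b]) M.
  rewrite Rintegral_cst //= lebesgue_measure_itv /= lte_fin.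
  by case: ltgtP ab => // ->; rewrite subrr.
apply: le_Rintegral => //.
by rewrite (_ : _ \o _ = abse \o (EFin \o h)) //; exact: integrable_abse.
Qed.

Section TwoFamilies.
Variables (P Q : R * R -> 'rV[R]_n) (tau : R * R -> R).
Hypothesis chP : space_change I q P.
Hypothesis chQ : space_change I q Q.
Hypothesis chtau : time_change I tau.
Hypothesis first_order : forall t, I t ->
  d_eps Q (0, t) = d_eps P (0, t) + time_velocity tau t *: derive1 q t.

(** [bh_state] and [alt_state] are the arguments of [L] in the two actions once
    both are pulled back to the original time [t]: the trajectory [P] read at
    the new time, and the trajectory [Q] read at the old time with its velocity
    rescaled. *)
Let retime (x : R * R) : R * R := (x.1, tau x).
Let bh_state (x : R * R) := (tau x, P (retime x), d_time P (retime x)).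
Let alt_state (x : R * R) := (tau x, Q x, (d_time tau x)^-1 *: d_time Q x).
Let gap (x : R * R) := d_time tau x *: (L (bh_state x) - L (alt_state x)).

Let tau0 t : I t -> tau (0, t) = t. Proof. by case: chtau => _; exact. Qed.
Let P0 t : I t -> P (0, t) = q t. Proof. by case: chP => _; exact. Qed.
Let Q0 t : I t -> Q (0, t) = q t. Proof. by case: chQ => _; exact. Qed.
Let retime0 t : I t -> retime (0, t) = (0, t).
Proof. by move=> /tau0 E; rewrite /retime E. Qed.

Let dtau0 t : I t -> d_time tau (0, t) = 1.
Proof. by move=> It; rewrite (d_time_initial tau0 It) derive1_id. Qed.

Let bh_state0 t : I t -> bh_state (0, t) = (t, q t, derive1 q t).
Proof.
move=> It; rewrite /bh_state retime0 // tau0 // P0 //.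
by rewrite (d_time_initial P0 It).
Qed.

Let alt_state0 t : I t -> alt_state (0, t) = (t, q t, derive1 q t).
Proof.
move=> It; rewrite /alt_state tau0 // Q0 // (d_time_initial Q0 It).
by rewrite dtau0 // invr1 scale1r.
Qed.

(** All conditions on [(eps, t)] that the integrands need are open and hold on
    [{0} x I], where both states equal [(t, q t, derive1 q t)]. *)
Lemma common_domain : exists N, [/\ open N,
    (forall t, I t -> N (0, t)),
    [/\ smooth_on N tau, smooth_on N Q, smooth_on N bh_state
      & smooth_on N alt_state],
    (forall x, N x -> 0 < d_time tau x) &
    forall x, N x -> [/\ U (bh_state x), U (alt_state x) &
      differentiable P (retime x) /\ {for retime x, continuous (d_time P)}] ].
Proof.
have [[N1 [oN1 IN1 _ sP]] _] := chP.
have [[N2 [oN2 IN2 _ sQ]] _] := chQ.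
have [[N3 [oN3 IN3 _ st]] _] := chtau.
have oN23 : open (N2 `&` N3) by exact: openI.
have sT : smooth_on (N2 `&` N3) retime.
  move=> k; apply: Ck_pair => //; first exact: Ck_fst.
  by apply: CkW (st k) => x [].
pose N4 := (N2 `&` N3) `&` retime @^-1` N1.
have oN4 : open N4.
  by apply: open_setI_preimage => // x Nx; exact: smooth_continuous sT Nx.
have sdt : smooth_on N4 (d_time tau).
  by move=> k; apply: CkW (smooth_derive _ st k) => x [[]].
pose N5 := N4 `&` (d_time tau) @^-1` [set y : R | 0 < y].
have oN5 : open N5.
  by apply: open_setI_preimage => // x Nx; exact: smooth_continuous sdt Nx.
have sT5 : smooth_on N5 retime by move=> k; apply: CkW (sT k) => x [[]].
have st5 : smooth_on N5 tau by move=> k; apply: CkW (st k) => x [[[]]].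
have sQ5 : smooth_on N5 Q by move=> k; apply: CkW (sQ k) => x [[[]]].
have sc1 : smooth_on N5 bh_state.
  have comp (W : normedModType R) (f : R * R -> W) :
      smooth_on N1 f -> smooth_on N5 (f \o retime).
    move=> sf k; apply: (Ck_comp finite_coordinates_plane oN5 _ (sT5 k) (sf k)).
    by move=> x [[]].
  move=> k; apply: Ck_pair => //; last exact: comp (smooth_derive _ sP) k.
  by apply: Ck_pair => //; exact: comp sP k.
have sc2 : smooth_on N5 alt_state.
  move=> k; apply: Ck_pair => //.
    by apply: Ck_pair; [|exact: st5|exact: sQ5].
  apply: Ck_scale => //; last exact: smooth_derive sQ5 k.
  apply: (Ck_comp finite_coordinates_real oN5 _ _ (Ck_inv k)).
    by move=> x [_ /= /lt0r_neq0].
  by apply: CkW (sdt k) => x [].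
pose N6 := N5 `&` bh_state @^-1` U.
have oN6 : open N6.
  by apply: open_setI_preimage => // x Nx; exact: smooth_continuous sc1 Nx.
pose N7 := N6 `&` alt_state @^-1` U.
have oN7 : open N7.
  apply: open_setI_preimage => // x [Nx _]; exact: smooth_continuous sc2 Nx.
have sub75 : N7 `<=` N5 by move=> x [[]].
exists N7; split=> //.
- move=> t It; have Ut := domq It.
  split; last by rewrite /preimage /= alt_state0.
  split; last by rewrite /preimage /= bh_state0.
  split; last by rewrite /preimage /= dtau0.
  split; first by split; [exact: IN2|exact: IN3].
  by rewrite /preimage /= retime0 //; exact: IN1.
- split=> k; [exact: CkW sub75 (st5 k)|exact: CkW sub75 (sQ5 k)| |].
    exact: CkW sub75 (sc1 k).
  exact: CkW sub75 (sc2 k).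
- by move=> x /sub75[].
- move=> x N7x; have [[_ U1] U2] := N7x; split=> //.
  have [[_ N1T] _] := sub75 _ N7x; split; first exact: smooth_diff sP N1T.
  exact: smooth_continuous (smooth_derive _ sP) N1T.
Qed.

Let velocityE t : time_velocity tau t = d_eps tau (0, t).
Proof. exact: (congr1 (fun F => F 0) (derive1_eps tau t)). Qed.

Lemma d_eps_retimed (W : normedModType R) (f : R * R -> W) t : I t ->
  differentiable f (0, t) -> differentiable tau (0, t) ->
  d_eps (f \o retime) (0, t) =
  d_eps f (0, t) + time_velocity tau t *: d_time f (0, t).
Proof.
move=> It df dtau; rewrite velocityE.
by apply: d_eps_reparametrized => //; exact: tau0.
Qed.

(** Write [s] for the time velocity.  For the velocity components, retiming [P]
    adds [s q''].  On the other side, by Schwarz's theorem, the derivative in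
    [eps] of [d_time Q] is the time derivative of [d_eps P + s q'] and so adds
    [s q'' + s' q'], and the division by [d_time tau] subtracts [s' q']. *)
Lemma d_eps_states t : I t -> d_eps bh_state (0, t) = d_eps alt_state (0, t).
Proof.
move=> It.
have [[N1 [oN1 IN1 _ sP]] _] := chP.
have [[N2 [oN2 IN2 _ sQ]] _] := chQ.
have [[N3 [oN3 IN3 _ st]] _] := chtau.
have N1t := IN1 t It; have N2t := IN2 t It; have N3t := IN3 t It.
have dP := smooth_diff sP N1t.
have dQ := smooth_diff sQ N2t.
have dt := smooth_diff st N3t.
have ddP := smooth_diff (smooth_derive ((0, 1) : R * R) sP) N1t.
have edP := smooth_diff (smooth_derive ((1, 0) : R * R) sP) N1t.
have ddQ := smooth_diff (smooth_derive ((0, 1) : R * R) sQ) N2t.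
have ddt := smooth_diff (smooth_derive ((0, 1) : R * R) st) N3t.
have edt := smooth_diff (smooth_derive ((1, 0) : R * R) st) N3t.
have dfst := differentiable_fst ((0, t) : R * R).
have dq' : differentiable (derive1 q) t.
  have := smooth_diff (@smooth_derive R R _ I q 1 smoothq) It.
  rewrite (_ : (fun x => 'D_1 q x) = derive1 q) //.
  by apply/funext => s; rewrite derive1E.
have dv : differentiable (time_velocity tau) t.
  have -> : time_velocity tau = fun s => d_eps tau (0, s) by exact/funext.
  exact: differentiable_time edt.
have rowc := @finite_coordinates_row R n.
(* Differentiate the first-order hypothesis in [t]. *)
have eqQ : d_eps (d_time Q) (0, t) = d_eps (d_time P) (0, t) +
    (time_velocity tau t *: derive1 (derive1 q) t +
     derive1 (time_velocity tau) t *: derive1 q t).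
  rewrite {1}/d_eps (derive_comm_vector _ _ rowc oN2 sQ N2t).
  rewrite -[LHS]/(d_time (d_eps Q) (0, t)) (d_time_initial first_order It).
  rewrite /d_eps (derive_comm_vector _ _ rowc oN1 sP N1t).
  rewrite -[in RHS]/(d_time (d_eps P) (0, t)).
  have <- : derive1 (fun s => d_eps P (0, s)) t = d_time (d_eps P) (0, t).
    by rewrite derive1_time.
  have dPs : derivable (fun s => d_eps P (0, s)) t 1.
    exact: diff_derivable (differentiable_time edP).
  have ds : derivable (fun s => time_velocity tau s *: derive1 q s) t 1.
    by apply: diff_derivable; have [] := is_diff_scale dv dq'.
  rewrite [LHS]derive1E (deriveD dPs ds).
  by rewrite (derive_scale _ dv dq') -3!derive1E.
have et' : d_eps (d_time tau) (0, t) = derive1 (time_velocity tau) t.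
  rewrite /d_eps (derive_comm_vector _ _ finite_coordinates_real oN3 st N3t).
  rewrite -[LHS]/(d_time (d_eps tau) (0, t)).
  by rewrite (d_time_initial (g := time_velocity tau) _ It).
have dPT : differentiable (P \o retime) (0, t).
  apply: differentiable_comp; last by rewrite retime0.
  by apply: differentiable_pair => //; exact: dfst.
have ddPT : differentiable (d_time P \o retime) (0, t).
  apply: differentiable_comp; last by rewrite retime0.
  by apply: differentiable_pair => //; exact: dfst.
have dtau_neq0 : d_time tau (0, t) != 0 by rewrite dtau0 // oner_neq0.
have dinv : differentiable (@GRing.inv R : R -> R) (d_time tau (0, t)).
  exact: differentiable_Rinv.
have dti : differentiable ((@GRing.inv R : R -> R) \o d_time tau) (0, t).
  exact: differentiable_comp.
have Ec1 : d_eps bh_state (0, t) = (d_eps tau (0, t),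
    d_eps (P \o retime) (0, t), d_eps (d_time P \o retime) (0, t)).
  have dtPT := differentiable_pair dt dPT.
  rewrite /d_eps; etransitivity; first exact: derive_pair _ dtPT ddPT.
  by rewrite (derive_pair _ dt dPT).
have dw : differentiable (fun x => (d_time tau x)^-1 *: d_time Q x) (0, t).
  by have [] := is_diff_scale dti ddQ.
have Ec2 : d_eps alt_state (0, t) = (d_eps tau (0, t), d_eps Q (0, t),
    d_eps (fun x => (d_time tau x)^-1 *: d_time Q x) (0, t)).
  have dtQ := differentiable_pair dt dQ.
  rewrite /d_eps; etransitivity; first exact: derive_pair _ dtQ dw.
  by rewrite (derive_pair _ dt dQ).
have Ew : d_eps (fun x => (d_time tau x)^-1 *: d_time Q x) (0, t) =
    d_eps (d_time Q) (0, t) - derive1 (time_velocity tau) t *: derive1 q t.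
  have Ei : 'D_((1, 0) : R * R) ((@GRing.inv R : R -> R) \o d_time tau) (0, t) =
      - derive1 (time_velocity tau) t.
    rewrite (derive_comp _ ddt dinv) -et'.
    rewrite -[LHS](deriveE (d_eps (d_time tau) (0, t)) dinv).
    etransitivity; first exact: derive_Rinv _ dtau_neq0.
    by rewrite (dtau0 It) invr1 mulr1 mulN1r.
  rewrite {1}/d_eps; etransitivity; first exact: derive_scale _ dti ddQ.
  rewrite Ei [((_ \o _) _)]/= (dtau0 It) invr1 scale1r scaleNr.
  by congr (_ - _ *: _); exact: d_time_initial Q0 It.
rewrite Ec1 Ec2 Ew eqQ (d_eps_retimed It dP dt) (d_eps_retimed It ddP dt).
rewrite (first_order It) (d_time_initial P0 It).
(* The terms with the derivative of the time velocity cancel. *)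
congr (_, _, _); rewrite -addrA addrK.
by rewrite (d_time_initial (fun s Is => d_time_initial P0 Is) It).
Qed.

(** The gap of the integrands has the factor [L bh_state - L alt_state], whose
    two terms have equal states with equal derivatives in [eps]. *)
Lemma gap_first_order t : I t -> gap (0, t) = 0 /\ d_eps gap (0, t) = 0.
Proof.
move=> It.
have [N [oN IN [st sQ sc1 sc2] _ NU]] := common_domain.
have N0 := IN t It; have [U1 U2 _] := NU _ N0.
have cE : bh_state (0, t) = alt_state (0, t) by rewrite bh_state0 // alt_state0.
split; first by rewrite /gap cE subrr scaler0.
have dc1 := smooth_diff sc1 N0.
have dc2 := smooth_diff sc2 N0.
have dL1 := smooth_diff smoothL U1.
have dL2 := smooth_diff smoothL U2.
have dLc1 : differentiable (L \o bh_state) (0, t).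
  exact: differentiable_comp.
have dLc2 : differentiable (L \o alt_state) (0, t).
  exact: differentiable_comp.
have dLc : differentiable ((L \o bh_state) - (L \o alt_state)) (0, t).
  exact: differentiableB.
have ddt := smooth_diff (smooth_derive ((0, 1) : R * R) st) N0.
have EL : 'D_((1, 0) : R * R) ((L \o bh_state) - (L \o alt_state)) (0, t) = 0.
  have e1 : derivable (L \o bh_state) (0, t) ((1, 0) : R * R).
    exact: diff_derivable.
  have e2 : derivable (L \o alt_state) (0, t) ((1, 0) : R * R).
    exact: diff_derivable.
  rewrite (deriveB e1 e2).
  rewrite (derive_comp _ dc1 dL1) (derive_comp _ dc2 dL2) cE.
  have -> : 'D_((1, 0) : R * R) bh_state (0, t) =
      'D_((1, 0) : R * R) alt_state (0, t) by exact: d_eps_states.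
  by rewrite subrr.
rewrite /d_eps; etransitivity; first exact: derive_scale _ ddt dLc.
by rewrite EL scaler0 add0r !fctE cE subrr scaler0.
Qed.

(** Near [eps = 0] the difference of the two actions is the integral of the gap
    over the fixed segment [[a, b]], hence [o(eps)].  The dummy value [d] is
    left free for the case where the end points are exchanged. *)
Lemma ordered_actions_agree (a b d : R) : I a -> I b -> a <= b ->
  is_derive (0 : R) 1 (fun e =>
    action L (tau (e, a)) (tau (e, b)) (fun t => P (e, t))
    - action L (tau (e, a)) (tau (e, b))
        (fun s => Q (e, 'pinv_(fun=> d) `[a, b] (fun t => tau (e, t)) s))) 0.
Proof.
move=> Ia Ib ab; have [N [oN IN [stau sQ sc1 sc2] tau'gt0 NU]] := common_domain.
have Iab t : a <= t <= b -> I t by exact: itvI.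
have sL1 : smooth_on N (L \o bh_state).
  by move=> k; apply: Ck_comp (sc1 k) (smoothL k) => //;
    [exact: finite_coordinates_phase|move=> x /NU[]].
have sL2 : smooth_on N (L \o alt_state).
  by move=> k; apply: Ck_comp (sc2 k) (smoothL k) => //;
    [exact: finite_coordinates_phase|move=> x /NU[]].
have sgap : smooth_on N gap.
  move=> k; apply: Ck_scale => //; first exact: (smooth_derive _ stau).
  have := Ck_add oN (sL1 k) (Ck_scale oN (Ck_cst k N (-1 : R)) (sL2 k)).
  by apply: Ck_ext => // x _; rewrite /= scaleN1r.
have gap0 t : a <= t <= b ->
    [/\ N (0, t), gap (0, t) = 0 & d_eps gap (0, t) = 0].
  by move=> /Iab It; have [] := gap_first_order It; split=> //; exact: IN.
have unif := uniformly_little_o oN (sgap 1%N) gap0.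
have segN : \forall e \near (0 : R), forall t, a <= t <= b -> N (e, t).
  by apply: near_segment => t /Iab/IN N0t; exact: open_nbhs_nbhs.
apply: is_derive0_of_little_o => eta eta0.
(* The summand [1] keeps the denominator positive when [a = b]. *)
pose k := eta / (b - a + 1).
have ba0 : 0 <= b - a by rewrite subr_ge0.
have ba1 : 0 < b - a + 1 by rewrite ltr_wpDl.
have k0 : 0 < k by rewrite divr_gt0.
apply: filterS2 segN (unif k k0) => e Ne ke.
have D1 : derive1 (fun t => tau (e, t)) = fun t => d_time tau (e, t).
  exact: derive1_time.
have dF t : a <= t <= b -> derivable (fun t => tau (e, t)) t 1.
  move=> /Ne Nt; apply/diff_derivable/differentiable_time.
  exact: smooth_diff stau Nt.
have cF t : a <= t <= b -> {for t, continuous (derive1 (fun t => tau (e, t)))}.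
  move=> /Ne Nt; rewrite D1; apply: continuous_time.
  exact: smooth_continuous (smooth_derive _ stau) Nt.
have F0 t : a <= t <= b -> 0 < derive1 (fun t => tau (e, t)) t.
  by move=> /Ne Nt; rewrite D1; exact: tau'gt0.
have A1 : action L (tau (e, a)) (tau (e, b)) (fun t => P (e, t)) =
    \int[mu]_(t in `[a, b]) (L (bh_state (e, t)) * d_time tau (e, t)).
  rewrite (action_change ab dF cF F0) => [|t tab].
    by rewrite !derive1_time.
  rewrite derive1_time.
  have [Uc _ [dP cP]] := NU _ (Ne t tab).
  apply: (@continuous_comp _ _ _ (fun s => (s, P (e, s), d_time P (e, s))) L).
    have cP' := differentiable_continuous dP.
    apply: (@cvg_pair _ _ _ (nbhs (tau (e, t)))
        (nbhs (tau (e, t), P (retime (e, t))))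
        (nbhs (d_time P (retime (e, t))))); last exact: continuous_time cP.
    apply: (@cvg_pair _ _ _ (nbhs (tau (e, t))) (nbhs (tau (e, t)))
        (nbhs (P (retime (e, t))))).
      exact: cvg_id.
    exact: continuous_time cP'.
  exact: smooth_continuous smoothL Uc.
have A2 : action L (tau (e, a)) (tau (e, b))
        (fun s => Q (e, 'pinv_(fun=> d) `[a, b] (fun t => tau (e, t)) s)) =
    \int[mu]_(t in `[a, b]) (L (alt_state (e, t)) * d_time tau (e, t)).
  have := action_inverse_change ab dF cF F0 d (L := L) (Q := fun t => Q (e, t)).
  rewrite !derive1_time => -> // t tab.
    apply: differentiable_time; exact: smooth_diff sQ (Ne t tab).
  exact: (continuous_time (smooth_continuous sL2 (Ne t tab))).
have cLd (c : R * R -> R * 'rV[R]_n * 'rV[R]_n) : smooth_on N (L \o c) ->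
    mu.-integrable `[a, b]
      (EFin \o (fun t => L (c (e, t)) * d_time tau (e, t))).
  move=> sLc; apply: continuous_compact_integrable.
    exact: segment_compact.
  apply: continuous_within => t /Ne Nt.
  apply: (@continuousM _ _ (fun t => L (c (e, t)))
    (fun t => d_time tau (e, t))).
    exact: (continuous_time (smooth_continuous sLc Nt)).
  exact: (continuous_time (smooth_continuous (smooth_derive _ stau) Nt)).
rewrite A1 A2.
have -> : \int[mu]_(t in `[a, b]) (L (bh_state (e, t)) * d_time tau (e, t)) -
    \int[mu]_(t in `[a, b]) (L (alt_state (e, t)) * d_time tau (e, t)) =
    \int[mu]_(t in `[a, b]) gap (e, t).
  rewrite -RintegralB //; [|exact: cLd|exact: cLd].
  by apply: eq_Rintegral => t _; rewrite /gap -mulrBl mulrC.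
apply: le_trans (@Rintegral_bound _ a b (k * `|e|) ab _ _) _.
- move=> t /Ne Nt; apply: continuous_time; exact: smooth_continuous sgap Nt.
- exact: ke.
rewrite mulrAC ler_wpM2r // /k mulrAC ler_pdivrMr // ler_pM2l //.
by rewrite lerDl.
Qed.

Lemma actions_agree (a b : R) : I a -> I b ->
  is_derive (0 : R) 1 (fun e =>
    action L (tau (e, a)) (tau (e, b)) (fun t => P (e, t))
    - action L (tau (e, a)) (tau (e, b))
        (fun s => Q (e, time_inverse tau a b e s))) 0.
Proof.
move=> Ia Ib; rewrite /time_inverse; case: (leP a b) => ab.
  exact: ordered_actions_agree.
have H := ordered_actions_agree a Ib Ia (ltW ab).
have HN := is_deriveN H; rewrite oppr0 in HN.
apply: (near_eq_is_derive _ HN); near=> e.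
rewrite !fctE /action 2!(oriented_integralC (tau (e, b))).
by rewrite opprB opprK addrC.
Unshelve. all: by end_near. Qed.

(** The two functions of [eps] that the invariances ask to be stationary differ
    by [o(eps)], whatever [G]. *)
Theorem BH_invariant_iff_alt (G : R * R -> R) :
  BH_invariant L I P tau G <-> alt_BH_invariant L I Q tau G.
Proof.
split=> inv a b Ia Ib; have E := actions_agree Ia Ib;
  have H := inv a b Ia Ib.
- have HB := is_deriveB H E; rewrite subr0 in HB.
  apply: (near_eq_is_derive _ HB); near=> e.
  by rewrite !fctE /= opprB addrC addrA addrA subrK.
- have HB := is_deriveD H E; rewrite addr0 in HB.
  apply: (near_eq_is_derive _ HB); near=> e.
  by rewrite !fctE /= addrC addrA addrA subrK.
Unshelve. all: by end_near. Qed.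

End TwoFamilies.

(** * Shifts of a trajectory by a time velocity *)

Lemma smooth_time_velocity (tau : R * R -> R) :
  time_change I tau -> smooth_on I (time_velocity tau).
Proof.
move=> [[N [oN IN _ st]] _] k.
have C0 : Ck_on k I (fun t : R => (0, t) : R * R).
  exact: Ck_linear (@inr_linear_continuous R R R).
have := Ck_comp finite_coordinates_plane open_I IN C0
  (smooth_derive ((1, 0) : R * R) st k).
apply: Ck_ext => // t _.
exact/esym/(congr1 (fun F => F 0) (derive1_eps tau t)).
Qed.

Section Shifts.
Variables (v : R -> R) (P : R * R -> 'rV[R]_n).
Hypothesis smoothv : smooth_on I v.
Hypothesis chP : space_change I q P.

Lemma shift_arg_space_change : space_change I q (shift_arg v P).
Proof.
have [[N [oN IN NI sP]] P0] := chP.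
split; last by move=> t It; rewrite /shift_arg mul0r addr0 P0.
pose S (x : R * R) : R * R := (x.1, x.2 + x.1 * v x.2).
have sS : smooth_on N S.
  move=> k; have Cv : Ck_on k N (v \o snd).
    by apply: Ck_comp (Ck_snd _ _) (smoothv k) => //;
      exact: finite_coordinates_real.
  have := Ck_pair oN (Ck_fst k N)
    (Ck_add oN (Ck_snd k N) (Ck_scale oN (Ck_fst k N) Cv)).
  by apply: Ck_ext.
exists (N `&` S @^-1` N); split.
- by apply: open_setI_preimage => // x Nx; exact: smooth_continuous sS Nx.
- by move=> t It; split; rewrite /preimage /= /S /= ?mul0r ?addr0; exact: IN.
- by move=> x [/NI].
- have oNS : open (N `&` S @^-1` N).
    by apply: open_setI_preimage => // x Nx; exact: smooth_continuous sS Nx.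
  move=> k; apply: (Ck_comp finite_coordinates_plane oNS _ _ (sP k)).
    by move=> x [].
  by apply: CkW (sS k) => x [].
Qed.

Lemma shift_arg_d_eps t : I t ->
  d_eps (shift_arg v P) (0, t) = d_eps P (0, t) + v t *: derive1 q t.
Proof.
have [[N [oN IN NI sP]] P0] := chP; move=> It.
have dP := smooth_diff sP (IN t It).
pose s (x : R * R) : R := x.2 + x.1 * v x.2.
have dsnd := differentiable_snd ((0, t) : R * R).
have dv : differentiable (v \o snd) ((0, t) : R * R).
  by apply: differentiable_comp => //; exact: smooth_diff smoothv It.
have ds : differentiable s (0, t).
  exact: differentiableD dsnd (differentiableM (differentiable_fst _) dv).
have es : d_eps s (0, t) = v t.
  have <- : derive1 (fun e => t + e * v t) 0 = d_eps s (0, t).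
    exact: (congr1 (fun F => F 0) (derive1_eps s t)).
  rewrite derive1E; have H : is_derive (0 : R) 1 (cst t + id * cst (v t)) (v t).
    by apply: is_derive_eq; rewrite add0r scaler0 add0r [_ *: _]mulr1.
  exact: (@derive_val _ _ _ _ _ _ _ H).
have s0 : s (0, t) = t by rewrite /s mul0r addr0.
have := d_eps_reparametrized dP ds s0.
by rewrite es (d_time_initial P0 It).
Qed.

Lemma shift_val_space_change : space_change I q (shift_val v q P).
Proof.
have [[N [oN IN NI sP]] P0] := chP.
split; last by move=> t It; rewrite /shift_val mul0r scale0r addr0 P0.
exists N; split=> // k.
have compI (W : normedModType R) (f : R -> W) :
    Ck_on k I f -> Ck_on k N (f \o snd).
  move=> Cf; apply: Ck_comp (Ck_snd _ _) Cf => //.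
  exact: finite_coordinates_real.
apply: (Ck_add oN (sP k)); apply: (Ck_scale oN).
  apply: (Ck_scale (f := v \o snd) oN); first exact: Ck_fst.
  exact: compI (smoothv k).
apply: (compI _ (derive1 q)).
rewrite (_ : derive1 q = fun x => 'D_1 q x).
  exact: (smooth_derive _ smoothq).
by apply/funext => t; rewrite derive1E.
Qed.

Lemma shift_val_d_eps t : I t ->
  d_eps (shift_val v q P) (0, t) = d_eps P (0, t) + v t *: derive1 q t.
Proof.
have [[N [oN IN NI sP]] P0] := chP; move=> It.
have dP := smooth_diff sP (IN t It).
have <- : derive1 (fun e => P (e, t) + (e * v t) *: derive1 q t) 0 =
    d_eps (shift_val v q P) (0, t).
  exact: (congr1 (fun F => F 0) (derive1_eps (shift_val v q P) t)).
have <- : derive1 (fun e => P (e, t)) 0 = d_eps P (0, t).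
  exact: (congr1 (fun F => F 0) (derive1_eps P t)).
have dPe : derivable (fun e => P (e, t)) 0 1.
  apply/derivable1_diffP.
  by apply: (@differentiable_comp _ _ _ _ (fun e => (e, t)) P).
have dl : differentiable (fun e : R => e *: (v t *: derive1 q t)) (0 : R).
  exact: differentiableZl.
have -> : (fun e => P (e, t) + (e * v t) *: derive1 q t) =
    (fun e => P (e, t)) + (fun e : R => e *: (v t *: derive1 q t)).
  by apply/funext => e; rewrite fctE scalerA.
rewrite [LHS]derive1E (deriveD dPe (diff_derivable dl)) -derive1E.
congr (_ + _).
by rewrite (deriveE _ dl) diffZl //= diff_val scale1r.
Qed.

End Shifts.
End FirstOrder.

Unset Implicit Arguments.

Theorem theorem8 (R : realType) (n : nat) (n_ge1 : (1 <= n)%N)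
    (U : set (R * 'rV[R]_n * 'rV[R]_n)) (L : R * 'rV[R]_n * 'rV[R]_n -> R)
    (I : set R) (q : R -> 'rV[R]_n)
    (openU : open U) (smoothL : smooth_on U L)
    (openI : open I) (itvI : is_interval I)
    (smoothq : smooth_on I q)
    (domq : forall t, I t -> U (t, q t, derive1 q t)) :
  (forall (qe : R * R -> 'rV[R]_n) (tau G : R * R -> R),
     space_change I q qe -> time_change I tau -> BH_function I G ->
     BH_invariant L I qe tau G ->
     forall Q1 : R * R -> 'rV[R]_n,
       Q1 = shift_arg (time_velocity tau) qe \/
       Q1 = shift_val (time_velocity tau) q qe ->
       space_change I q Q1 /\ alt_BH_invariant L I Q1 tau G)
  /\
  (forall (qe : R * R -> 'rV[R]_n) (theta G : R * R -> R),
     space_change I q qe -> time_change I theta -> BH_function I G ->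
     alt_BH_invariant L I qe theta G ->
     forall Q2 : R * R -> 'rV[R]_n,
       Q2 = shift_arg (fun t => - time_velocity theta t) qe \/
       Q2 = shift_val (fun t => - time_velocity theta t) q qe ->
       space_change I q Q2 /\ BH_invariant L I Q2 theta G).
Proof.
have shift v qe Q : smooth_on I v -> space_change I q qe ->
    Q = shift_arg v qe \/ Q = shift_val v q qe ->
    space_change I q Q /\
    forall t, I t -> d_eps Q (0, t) = d_eps qe (0, t) + v t *: derive1 q t.
  move=> sv cq [] ->; split.
  - exact: shift_arg_space_change.
  - by move=> t; exact: shift_arg_d_eps.
  - exact: shift_val_space_change.
  - by move=> t; exact: shift_val_d_eps.
split=> [qe tau|qe theta] G cq ct _ inv Q HQ.
- have [cQ dQ] := shift _ _ _ (smooth_time_velocity openI ct) cq HQ.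
  split; first exact: cQ.
  exact: (BH_invariant_iff_alt openU smoothL openI itvI smoothq domq
    cq cQ ct dQ G).1 inv.
- have sN : smooth_on I (fun t => - time_velocity theta t).
    move=> k; have := Ck_scale openI (Ck_cst k I (-1 : R))
      (smooth_time_velocity openI ct k).
    by apply: Ck_ext => // t _; rewrite /= scaleN1r.
  have [cQ dQ] := shift _ _ _ sN cq HQ; split; first exact: cQ.
  (* Solved for [qe], the first-order relation is the one of part (i) with the
     roles of the old and the new family exchanged. *)
  have d t : I t ->
      d_eps qe (0, t) = d_eps Q (0, t) + time_velocity theta t *: derive1 q t.
    by move=> It; rewrite dQ // scaleNr subrK.
  exact: (BH_invariant_iff_alt openU smoothL openI itvI smoothq domq
    cQ cq ct d G).2 inv.
Qed.
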